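(* Let $G$ and $H$ be finite graphs and let $D$ be a dominating set of $G\Box H$. If there is a dominating set $S$ of $G$ such that for every $h\in V(H)$ we have $S\in M_G(p_G(D\cap G_h))$, then $|D|\geq \gamma(G)\gamma(H)$.
   Context: $\gamma(X)$ denotes the domination number of a graph $X$ (the minimum size of a dominating set). $G\Box H$ is the Cartesian product of $G$ and $H$. For $h\in V(H)$, $G_h=\{(g,h)\mid g\in V(G)\}$ is the $G$-layer at $h$. The projection $p_G:V(G\Box H)\to V(G)$ is $p_G(g,h)=g$. For $X\subseteq V(G)$, a minimal dominating set of $G$ containing $X$ is a dominating set $S$ of $G$ with $X\subseteq S$ such that no set $S'$ with $X\subseteq S'\subsetneq S$ is a dominating set of $G$; $M_G(X)$ denotes the set of all minimal dominating sets of $G$ containing $X$. *)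

(* Defs.v *)
From mathcomp Require Import all_boot.

Set Implicit Arguments.
Unset Strict Implicit.
Unset Printing Implicit Defensive.

Record sgraph := SGraph {
  vertex :> finType;
  adj : rel vertex;
  adj_sym : symmetric adj;
  adj_irrefl : irreflexive adj
}.

Section CartesianProduct.
Variables G H : sgraph.

Definition cart_adj : rel (G * H)%type := fun u v =>
  ((u.1 == v.1) && adj u.2 v.2) || ((u.2 == v.2) && adj u.1 v.1).

Lemma cart_adj_sym : symmetric cart_adj.
Proof.
by move=> u v; rewrite /cart_adj (adj_sym u.2) (adj_sym u.1) !(eq_sym (v.1)) !(eq_sym (v.2)).
Qed.

Lemma cart_adj_irrefl : irreflexive cart_adj.
Proof. by move=> u; rewrite /cart_adj !adj_irrefl !andbF. Qed.

Definition cart : sgraph := SGraph cart_adj_sym cart_adj_irrefl.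

Definition layerG (h : H) : {set cart} := [set (g, h) | g : G].

Definition projG (u : cart) : G := u.1.

End CartesianProduct.

Section Domination.
Variable G : sgraph.

Definition dominating (S : {set G}) : bool :=
  [forall v, (v \in S) || [exists u in S, adj u v]].

(* The default [set: G] of arg min is itself dominating, so the minimum is
   attained by a dominating set. *)
Definition domination_number : nat :=
  #|[arg min_(S < [set: G] | dominating S) #|S|]|.

Definition min_dominating_containing (X : {set G}) : {set {set G}} :=
  [set S : {set G} | [&& dominating S, X \subset S &
     [forall S' : {set G},
        (X \subset S') && (S' \proper S) ==> ~~ dominating S']]].

End Domination.

(* Main.v *)
Require Import Defs.
From mathcomp Require Import all_boot.

(** The hypothesis forces every vertex of [D] to project into [S], so [D] is
    the disjoint union of its fibres over the elements of [S].  Each fibre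
    dominates [H]: if [(s, h)] is not in [D], minimality gives a vertex [v]
    that no element of [S] other than [s] dominates, and the vertex of [D]
    dominating [(v, h)] can then only be some [(s, h')] with [h'] adjacent
    to [h]. *)

Lemma dominatingP (G : sgraph) (S : {set G}) :
  reflect (forall v, v \in S \/ exists2 u, u \in S & adj u v) (dominating S).
Proof.
apply: (iffP forallP) => domS v.
  by case/orP: (domS v) => [|/exists_inP]; [left | right].
by case: (domS v) => [->|vN] //; apply/orP; right; apply/exists_inP.
Qed.

Lemma domination_number_le (G : sgraph) (S : {set G}) :
  dominating S -> domination_number G <= #|S|.
Proof.
rewrite /domination_number; case: arg_minnP => [|T _ minT]; last exact: minT.
by apply/dominatingP => v; left.
Qed.

(** [S :\ s] still contains [X], so by minimality it leaves some [v] undominated; only [s] can then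
    equal or be adjacent to [v] within [S]. The case [v = s] is allowed. *)
Lemma private_neighbour (G : sgraph) (X S : {set G}) (s : G) :
  S \in min_dominating_containing X -> s \in S -> s \notin X ->
  exists v, forall u, u \in S -> (u == v) || adj u v -> u = s.
Proof.
rewrite inE => /and3P[_ subXS /forallP/(_ (S :\ s)) minS] sS sNX.
move: minS; rewrite properD1 // subsetD1 subXS sNX /=.
case/forallPn=> v; rewrite negb_or => /andP[vN /exists_inPn adjN].
exists v => u uS uv; apply/eqP; apply: contraLR uv => u_s.
have uSs : u \in S :\ s by rewrite !inE u_s.
by rewrite negb_or adjN // andbT; apply: contraNneq vN => <-.
Qed.

Section Fibres.
Variables G H : sgraph.
Implicit Types (D : {set cart G H}) (g : G) (h : H).

Definition fibre D g : {set H} := [set h | (g, h) \in D].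

Lemma mem_proj_layer D g h :
  (g \in @projG G H @: (D :&: layerG G h)) = ((g, h) \in D).
Proof.
apply/imsetP/idP => [[u /setIP[uD /imsetP[g' _ def_u]] ->]|ghD].
  by rewrite def_u in uD *.
by exists (g, h); rewrite // inE ghD; apply/imsetP; exists g.
Qed.

Lemma card_fibres D : #|D| = \sum_g #|fibre D g|.
Proof.
(* Splitting [u] into coordinates lets the sum over pairs become a double sum. *)
rewrite -sum1_card (eq_bigl (fun u => (u.1, u.2) \in D)); last by case.
rewrite -(pair_big_dep xpredT (fun g h => (g, h) \in D) (fun _ _ => 1)) /=.
by apply: eq_bigr => g _; rewrite -sum1_card; apply: eq_bigl => h; rewrite inE.
Qed.

Lemma fibre_dominating D (S : {set G}) (s : G) :
  dominating D -> s \in S ->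
  (forall h, S \in min_dominating_containing (@projG G H @: (D :&: layerG G h))) ->
  dominating (fibre D s).
Proof.
move=> /dominatingP domD sS minS.
have DS g h : (g, h) \in D -> g \in S.
  rewrite -mem_proj_layer; have:= minS h.
  by rewrite inE => /and3P[_ /subsetP + _]; apply.
apply/dominatingP => h; rewrite inE.
have [shD|shN] := boolP ((s, h) \in D); first by left.
right; have [|v priv] := private_neighbour _ _ _ _ (minS h) sS.
  by rewrite mem_proj_layer.
(* Inside the layer at [h] nothing in [D] dominates [(v, h)]: it would have to be [(s, h)]. *)
have no_h g : (g, h) \in D -> (g == v) || adj g v -> False.
  by move=> ghD /(priv g (DS _ _ ghD)) gs; rewrite gs (negPf shN) in ghD.
case: (domD (v, h)) => [vhD|[[g h'] ghD]].
  by case: (no_h v vhD); rewrite eqxx.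
(* An edge within the layer at [h] is excluded by [no_h]; an edge along [H] keeps the first
   coordinate, so [g = v], which forces [g = s]. *)
case/orP=> /= /andP[/eqP eq_ adj_]; last first.
  by rewrite eq_ in ghD; case: (no_h g ghD); rewrite adj_ orbT.
have gs : g = s by apply: priv (DS _ _ ghD) _; rewrite eq_ eqxx.
by exists h'; rewrite // inE -gs.
Qed.

End Fibres.

Theorem theorem1 (G H : sgraph) (D : {set cart G H}) :
  dominating D ->
  (exists S : {set G}, dominating S /\
     forall h : H,
       S \in min_dominating_containing (@projG G H @: (D :&: layerG G h))) ->
  #|D| >= domination_number G * domination_number H.
Proof.
move=> domD [S [domS minS]].
apply: leq_trans (leq_mul (domination_number_le _ _ domS) (leqnn _)) _.
(* The product becomes a constant sum over [S], bounded termwise by the fibres over [S]; the terms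
   outside [S] are dropped as nonnegative. *)
rewrite card_fibres -sum_nat_const [leqRHS](bigID [in S]) /=.
apply: leq_trans (leq_addr _ _); apply: leq_sum => s sS.
exact/domination_number_le/fibre_dominating/minS.
Qed.
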